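(* For every $c<2/3$, there exist integers $m,n$, a normalized $n$-fermion state $|\psi\rangle$ on $m$ modes, and a Slater determinant $|G\rangle$ such that $|\langle G|\psi\rangle|^2>c$ and $B_G=0$, but $|G\rangle$ is not globally closest to $|\psi\rangle$, i.e. there is a Slater determinant $|H\rangle$ with $|\langle H|\psi\rangle|^2>|\langle G|\psi\rangle|^2$. Hence, for $c<2/3$, there is no statement valid for all $m,n$ asserting that every Slater determinant $|G\rangle$ with $|\langle G|\psi\rangle|^2>c$ and $B_G=0$ is a globally closest Slater determinant to $|\psi\rangle$.
   Context: $\mathcal H_1$ is an $m$-dimensional complex Hilbert space, $n\le m$, $\mathcal H_n=\wedge^n\mathcal H_1$ is the $n$-fermion space on $m$ modes, and Slater determinants are the unit vectors $|\varphi_1\rangle\wedge\cdots\wedge|\varphi_n\rangle$ with $\varphi_i\in\mathcal H_1$ orthonormal. For a Slater determinant $|G\rangle=c_{g_1}^\dagger\cdots c_{g_n}^\dagger|0\rangle$ with orthonormal occupied orbitals $g_1,\dots,g_n$, let $f_1,\dots,f_{m-n}$ be an orthonormal basis of the orthogonal complement of $\operatorname{span}\{g_\mu\}$ in $\mathcal H_1$; $c_v^\dagger$ denotes the fermionic creation operator of orbital $v$. The Brillouin residual is $B_G=\sqrt{\sum_{a,\mu}|\langle G_{a\mu}|\psi\rangle|^2}$ where $|G_{a\mu}\rangle=c_{f_a}^\dagger c_{g_\mu}|G\rangle$. Globally closest to $|\psi\rangle$ means maximizing $|\langle S|\psi\rangle|^2$ over all Slater determinants $|S\rangle$. *)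

(* Defs.v *)
From HB Require Import structures.
From mathcomp Require Import all_boot all_order all_algebra.
From mathcomp Require Import sesquilinear spectral.
From mathcomp Require Import complex.
From mathcomp Require Import reals.

Set Implicit Arguments.
Unset Strict Implicit.
Unset Printing Implicit Defensive.

Import Order.TTheory GRing.Theory Num.Theory.
Local Open Scope ring_scope.

(* The one-particle space is C^m, as 'rV[R[i]]_m, with the library's inner
   product dotmx u v, antilinear in v.  Its exterior algebra is given in
   coordinates: psi A is the coefficient of psi on
   |A> = e_i1 /\ ... /\ e_ik, where A = {i1 < ... < ik}. *)
Definition fock (R : realType) (m : nat) := {ffun {set 'I_m} -> R[i]}.

Section Fock.
Variables (R : realType) (m : nat).
Local Notation C := R[i].
Implicit Types (phi psi : fock R m) (v : 'rV[C]_m) (A : {set 'I_m}).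

(* <phi|psi>, antilinear in phi *)
Definition braket phi psi : C := \sum_A Num.conj (phi A) * psi A.

Definition fidelity phi psi : R := Normc.normc (braket phi psi) ^+ 2.

Definition vacuum : fock R m := [ffun A : {set 'I_m} => (A == set0)%:R].

(* For i not in A, e_i /\ |A> = jw i A *: |i |: A>; note jw i (i |: A) = jw i A. *)
Definition jw (i : 'I_m) A : C := (-1) ^+ #|[set j in A | (j < i)%N]|.

(* c_v^dagger = \sum_i v_i c_i^dagger, that is, psi |-> v /\ psi *)
Definition create v psi : fock R m :=
  [ffun A : {set 'I_m} => \sum_(i in A) v 0 i * jw i A * psi (A :\ i)].

(* c_v = \sum_i (v_i)^* c_i *)
Definition annihilate v psi : fock R m :=
  [ffun A : {set 'I_m} => \sum_(i | i \notin A) Num.conj (v 0 i) * jw i A * psi (i |: A)].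

Lemma annihilate_adjoint v phi psi :
  braket (annihilate v phi) psi = braket phi (create v psi).
Proof.
rewrite /braket.
under eq_bigr => A _ do rewrite ffunE rmorph_sum /= mulr_suml.
under [RHS]eq_bigr => A _ do rewrite ffunE mulr_sumr.
rewrite !pair_big_dep /=.
rewrite [RHS](reindex_onto (fun p => (p.2 |: p.1, p.2)) (fun p => (p.1 :\ p.2, p.2)))
  /=; last by case=> A i /= iA; rewrite setD1K.
apply: eq_big => [[A i]|[A i] iA] /=.
  rewrite setU11 /= xpair_eqE eqxx andbT.
  apply/idP/eqP => [|<-]; last by rewrite !inE eqxx.
  exact: setU1K.
rewrite setU1K // !rmorphM /= conjCK /jw rmorphXn rmorphN rmorph1.
have -> : [set j in i |: A | (j < i)%N] = [set j in A | (j < i)%N].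
  by apply/setP=> j; rewrite !inE; case: eqVneq => [->|//]; rewrite ltnn !andbF.
by rewrite mulrC -!mulrA [LHS]mulrC !mulrA; congr (_ * _); rewrite mulrC !mulrA.
Qed.

Section Fermions.
Variable n : nat.
Implicit Types g : 'M[C]_(n, m).

(* psi lies in the n-th exterior power *)
Definition fermionic psi := forall A, psi A != 0 -> #|A| = n.

Definition normalized psi := braket psi psi = 1.

(* c_g1^dagger ... c_gn^dagger |0>, where g1, ..., gn are the rows of g *)
Definition slater g : fock R m :=
  foldr (fun mu => create (row mu g)) vacuum (enum 'I_n).

(* The rows of g are orthonormal iff g \is unitarymx (row_unitarymxP). *)
Definition is_slater phi := exists2 g, g \is unitarymx & phi = slater g.

Definition globally_closest psi phi :=
  is_slater phi /\
  forall chi, is_slater chi -> fidelity chi psi <= fidelity phi psi.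

(* The rows of f form an orthonormal basis of the orthogonal complement of
   the span of the rows of g. *)
Definition complement_basis g (f : 'M[C]_(m - n, m)) :=
  f \is unitarymx /\
  forall v, (v <= f)%MS <-> (forall mu, dotmx v (row mu g) = 0).

Definition single_excitation g (f : 'M[C]_(m - n, m)) a mu : fock R m :=
  create (row a f) (annihilate (row mu g) (slater g)).

(* The value does not depend on the choice of orthonormal g and f representing
   the given Slater determinant. *)
Definition brillouin g (f : 'M[C]_(m - n, m)) psi : R :=
  Num.sqrt (\sum_a \sum_mu fidelity (single_excitation g f a mu) psi).

End Fermions.
End Fock.

(* Main.v *)
Require Import Defs.
From mathcomp Require Import all_boot all_order all_algebra.
From mathcomp Require Import sesquilinear spectral.
From mathcomp Require Import complex.
From mathcomp Require Import reals.
From mathcomp Require Import zify ring lra.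

(** Take [2n] modes grouped in [n] pairs, with [G] filling the lower mode of
    each pair, and [psi = a G + b D] where [D] is the sum of the [n(n-1)/2]
    determinants in which exactly two pairs have their particle in the upper
    mode: [psi] has no single excitation, so [B_G = 0].  Rotating every pair by
    the angle of tangent [1/n] gives a determinant [H] with
    [<H|psi> = (1 + 1/n^2)^(-n/2) (a + b (n-1)/(2n))].  To leading order [H]
    wins as soon as [b (n-1) > a]; with [n = k+2] and [b = a/k], normalization
    gives [a^2 = 2k^2 / (3k^2 + 3k + 2)], which tends to [2/3]. *)

Set Implicit Arguments.
Unset Strict Implicit.
Unset Printing Implicit Defensive.

Import Order.TTheory GRing.Theory Num.Theory.
Local Open Scope ring_scope.
Local Open Scope complex_scope.

(** * Determinants whose orbitals are supported on consecutive disjoint blocks of modes *)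

Section BlockSlater.
Variables (R : realType) (m n : nat) (p : 'I_m -> 'I_n) (h : 'M[R[i]]_(n, m)).
Hypothesis p_mono : forall i j : 'I_m, (i <= j)%N -> (p i <= p j)%N.
Hypothesis h_block : forall mu j, h mu j != 0 -> p j = mu.

Let create_all (l : seq 'I_n) : fock R m :=
  foldr (fun mu => create (row mu h)) (vacuum R m) l.

(** Pigeonhole: [p @: A] has at most [#|A|] elements and contains the [#|A|] distinct entries of
    [l], so it consists of exactly these and [p] merges no two elements of [A]. *)
Lemma transversal_of_covering (l : seq 'I_n) (A : {set 'I_m}) :
  uniq l -> #|A| = size l -> {subset l <= p @: A} ->
  {in A &, injective p} /\ {in A, forall j, p j \in l}.
Proof.
move=> ul cA lA.
have sub : [set nu in l] \subset p @: A.
  by apply/subsetP => nu; rewrite inE => /lA.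
have cl : #|[set nu in l]| = #|A| by rewrite cA cardsE; apply/card_uniqP.
have cpA : #|p @: A| = #|A|.
  by apply/eqP; rewrite eqn_leq leq_imset_card -[X in (X <= _)%N]cl subset_leq_card.
split; first by apply/imset_injP/eqP.
have /eqP eqA : [set nu in l] == p @: A by rewrite eqEcard sub cl cpA /=.
by move=> j jA; have := imset_f p jA; rewrite -eqA inE.
Qed.

Lemma block_sum_neq0 nu (A : {set 'I_m}) :
  \sum_(j in A) h nu j != 0 -> nu \in p @: A.
Proof.
move=> nz; apply/negPn/negP => nuA; case/negP: nz; rewrite big1 // => j jA.
apply/eqP/negPn/negP => /h_block pj; case/negP: nuA.
by rewrite -pj imset_f.
Qed.

(* Off the transversals of the blocks some factor vanishes; on them every
   creation operator acts to the left of the occupied modes, so no sign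
   appears. *)
Lemma create_all_block (l : seq 'I_n) (A : {set 'I_m}) :
  sorted ltn (map val l) ->
  create_all l A =
  (#|A| == size l)%:R * \prod_(mu <- l) (\sum_(j in A) h mu j).
Proof.
elim: l A => [|mu l IH] A /=.
  by move=> _; rewrite /create_all /= ffunE big_nil mulr1 cards_eq0.
move=> sl; rewrite /create_all /= ffunE -/(create_all l) big_cons.
have sl' : sorted ltn (map val l) := path_sorted sl.
have ul : uniq (mu :: l).
  rewrite -(map_inj_uniq val_inj).
  exact: (sorted_uniq ltn_trans ltnn (s := map val (mu :: l))).
have mul nu : nu \in l -> (mu < nu)%N.
  move=> nul; have := order_path_min ltn_trans sl; move/allP => /(_ (val nu)).
  by apply; rewrite map_f.
rewrite mulr_suml mulr_sumr; apply: eq_bigr => i iA.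
rewrite IH // mxE.
have [-> | hi] := eqVneq (h mu i) 0; first by rewrite !(mul0r, mulr0).
have pi := h_block hi.
(* Mode [i] lies in block [mu], while every [nu] in [l] is strictly larger, so the row sums still to
   come do not see its removal. *)
have -> : \prod_(nu <- l) \sum_(j in A :\ i) h nu j =
          \prod_(nu <- l) \sum_(j in A) h nu j.
  apply: eq_big_seq => nu nul; rewrite [RHS](big_setD1 i) //=.
  have [-> | /h_block] := eqVneq (h nu i) 0; first by rewrite add0r.
  by rewrite pi => e; have := mul _ nul; rewrite e ltnn.
have -> : (#|A :\ i| == size l) = (#|A| == (size l).+1).
  by rewrite (cardsD1 i A) iA add1n eqSS.
have [cA|_] := eqVneq #|A|; last by rewrite !(mul0r, mulr0).
have [->|nz] := eqVneq (\prod_(nu <- l) \sum_(j in A) h nu j) 0.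
  by rewrite !mulr0.
have cov : {subset mu :: l <= p @: A}.
  move=> nu; rewrite inE => /orP[/eqP ->|nul]; first by rewrite -pi imset_f.
  by move: nz; rewrite prodf_seq_neq0 => /allP /(_ nu nul); apply: block_sum_neq0.
have [pinj pl] := transversal_of_covering ul cA cov.
rewrite /jw (_ : [set j in A | _] = set0).
  by rewrite cards0 expr0 mulr1 !mul1r.
apply/setP => j; rewrite !inE; apply/negP => /andP[jA ji].
have := pl j jA; rewrite inE => /orP[/eqP pj|/mul].
  by have := pinj _ _ jA iA; rewrite pj pi => /(_ erefl) e; rewrite e ltnn in ji.
by have := p_mono (ltnW ji); rewrite pi; lia.
Qed.

Lemma slater_block (A : {set 'I_m}) :
  slater h A = (#|A| == n)%:R * \prod_mu \sum_(j in A) h mu j.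
Proof.
rewrite /slater -/(create_all _) create_all_block.
  by rewrite size_enum_ord big_enum.
by rewrite val_enum_ord iota_ltn_sorted.
Qed.
End BlockSlater.

(** * Pairs of modes and the sets that choose one mode from each pair *)

Section Modes.
Variable n : nat.

Lemma mode_subproof (mu : 'I_n) (b : bool) : (b + mu.*2 < n.*2)%N.
Proof. by have := ltn_ord mu; case: b; lia. Qed.

(** The upper mode ([b = true]) is the odd one. Interleaving the two levels makes the pair index
    monotone in the mode index, as the block formula requires. *)
Definition mode mu b : 'I_n.*2 := Ordinal (mode_subproof mu b).

Lemma pair_subproof (j : 'I_n.*2) : (j./2 < n)%N.
Proof. by have := ltn_ord j; lia. Qed.

Definition pair_of j : 'I_n := Ordinal (pair_subproof j).

Lemma pair_of_mode mu b : pair_of (mode mu b) = mu.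
Proof. by apply: val_inj; rewrite /= half_bit_double. Qed.

Lemma odd_mode mu b : odd (mode mu b) = b.
Proof. by rewrite /= oddD odd_double addbF oddb. Qed.

Lemma pair_ofK j : mode (pair_of j) (odd j) = j.
Proof. by apply: val_inj; rewrite /= odd_double_half. Qed.

Lemma pair_of_mono (i j : 'I_n.*2) : (i <= j)%N -> (pair_of i <= pair_of j)%N.
Proof. exact: half_leq. Qed.

Lemma mode_inj2 mu nu b c : (mode mu b == mode nu c) = (mu == nu) && (b == c).
Proof.
apply/eqP/andP => [e|[/eqP -> /eqP ->] //].
by rewrite -(pair_of_mode mu b) -{2}(odd_mode mu b) e pair_of_mode odd_mode !eqxx.
Qed.

Lemma sum_modes (V : nmodType) (F : 'I_n.*2 -> V) :
  \sum_j F j = \sum_mu (F (mode mu false) + F (mode mu true)).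
Proof.
rewrite (reindex (fun x : 'I_n * bool => mode x.1 x.2)) /=; last first.
  exists (fun j => (pair_of j, odd j)) => [[mu b] _|j _] /=.
    by rewrite pair_of_mode oddD odd_double addbF oddb.
  exact: pair_ofK.
rewrite -(pair_bigA _ (fun mu b => F (mode mu b))) /=.
by apply: eq_bigr => mu _; rewrite big_bool addrC.
Qed.

(** Here [s] is the set of pairs whose particle sits in the upper mode. *)
Definition transversal (s : {set 'I_n}) : {set 'I_n.*2} :=
  [set mode mu (mu \in s) | mu : 'I_n].

Definition excited (A : {set 'I_n.*2}) : {set 'I_n} := [set mu | mode mu true \in A].

Lemma mode_transversal mu b s : (mode mu b \in transversal s) = (b == (mu \in s)).
Proof.
apply/imsetP/eqP => [[nu _ /eqP]|->]; last by exists mu.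
by rewrite mode_inj2 => /andP[/eqP -> /eqP].
Qed.

Lemma transversalK s : excited (transversal s) = s.
Proof. by apply/setP => mu; rewrite inE mode_transversal; case: (mu \in s). Qed.

Lemma transversal_inj (s : {set 'I_n}) : injective (fun mu => mode mu (mu \in s)).
Proof. by move=> mu nu /eqP; rewrite mode_inj2 => /andP[/eqP]. Qed.

Lemma card_transversal s : #|transversal s| = n.
Proof. by rewrite card_imset ?card_ord //; apply: transversal_inj. Qed.

End Modes.

(** * Support of a state after one creation or annihilation *)

Section Fock.
Variables (R : realType) (m : nat).

Lemma create_neq0 (v : 'rV[R[i]]_m) (phi : fock R m) A : create v phi A != 0 ->
  exists i, [/\ i \in A, v 0 i != 0 & phi (A :\ i) != 0].
Proof.
rewrite ffunE => nz.
have [i /and3P[iA vi pi]|no] := pickP [pred i | [&& i \in A, v 0 i != 0 & phi (A :\ i) != 0]].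
  by exists i.
case/negP: nz; rewrite big1 // => i iA; have := no i; rewrite /= iA /=.
have [->|_] := eqVneq (v 0 i) 0; first by rewrite !mul0r.
by move=> /negbFE /eqP ->; rewrite mulr0.
Qed.

Lemma annihilate_neq0 (v : 'rV[R[i]]_m) (phi : fock R m) A :
  annihilate v phi A != 0 -> exists i, phi (i |: A) != 0.
Proof.
rewrite ffunE => nz.
have [i pi|no] := pickP [pred i | phi (i |: A) != 0]; first by exists i.
case/negP: nz; rewrite big1 // => i _.
by have /negbFE/eqP -> := no i; rewrite mulr0.
Qed.

End Fock.

(** * Determinants with all pairs rotated alike, and states supported on transversals *)

Section PairState.
Variables (R : realType) (n : nat).
Local Notation C := R[i].

(** The parameters [1, 0] give [G]; the cosine and sine of the rotation angle give [H]. *)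
Definition pair_mx (u v : C) : 'M[C]_(n, n.*2) :=
  \matrix_(mu, j) if pair_of j == mu then (if odd j then v else u) else 0.

Lemma pair_mx_mode u v mu nu b :
  pair_mx u v mu (mode nu b) = if nu == mu then (if b then v else u) else 0.
Proof. by rewrite mxE pair_of_mode odd_mode. Qed.

Lemma pair_mx_block u v mu j : pair_mx u v mu j != 0 -> pair_of j = mu.
Proof. by rewrite mxE; case: (pair_of j =P mu) => // _; rewrite eqxx. Qed.

Lemma pair_mx_unitary (u v : C) :
  u * Num.conj u + v * Num.conj v = 1 -> pair_mx u v \is unitarymx.
Proof.
move=> uv; apply/unitarymxP/matrixP => mu nu; rewrite !mxE sum_modes.
rewrite (bigD1 mu) //= big1 ?addr0 => [|l /negbTE nl].
  rewrite !mxE !pair_of_mode !odd_mode eqxx eq_sym.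
  by case: eqVneq => _; rewrite ?uv // rmorph0 !mulr0 addr0.
by rewrite !mxE !pair_of_mode nl !mul0r addr0.
Qed.

(** A transversal meets each pair in one mode, so every row sum in the block formula is a single
    entry: [v] on [s], [u] elsewhere. *)
Lemma slater_pair_mx u v s :
  slater (pair_mx u v) (transversal s) = u ^+ (n - #|s|) * v ^+ #|s|.
Proof.
rewrite (slater_block (@pair_of_mono n) (@pair_mx_block u v)).
rewrite card_transversal eqxx mul1r.
rewrite (eq_bigr (fun mu => if mu \in s then v else u)); last first.
  move=> mu _; rewrite big_imset /=; last by move=> ? ? _ _; apply: transversal_inj.
  rewrite (bigD1 mu) //= big1 ?addr0 => [|l /negbTE nl].
    by rewrite pair_mx_mode eqxx.
  by rewrite pair_mx_mode nl.
rewrite (bigID (mem s)) /= mulrC; congr (_ * _).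
  rewrite (eq_bigr (fun=> u)) => [|mu /negbTE -> //].
  rewrite prodr_const; congr (_ ^+ _).
  have -> : (n - #|s|)%N = #|~: s| by rewrite [RHS]cardsCs setCK card_ord.
  by apply: eq_card => mu; rewrite !inE.
by rewrite (eq_bigr (fun=> v)) ?prodr_const // => mu ->.
Qed.

Lemma slater_ground u A :
  slater (pair_mx u 0) A != 0 -> {in A, forall j : 'I_n.*2, ~~ odd j}.
Proof.
rewrite /slater; elim: (enum 'I_n) A => [|mu l IH] A /=.
  rewrite ffunE; have [-> _ j|_] := eqVneq A set0; first by rewrite inE.
  by rewrite eqxx.
case/create_neq0 => i [iA]; rewrite !mxE => hi /IH evenA j jA.
have [->|ji] := eqVneq j i; last by apply: evenA; rewrite !inE ji.
by move: hi; case: (_ =P mu) => _; rewrite ?eqxx //; case: odd; rewrite ?eqxx.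
Qed.

Variable w : nat -> C.

Definition pair_state : fock R n.*2 :=
  [ffun A : {set 'I_n.*2} =>
     if transversal (excited A) == A then w #|excited A| else 0].

Lemma fermionic_pair_state : fermionic n pair_state.
Proof.
move=> A; rewrite ffunE; case: (_ =P A) => [<- _|]; last by rewrite eqxx.
exact: card_transversal.
Qed.

Lemma braket_pair_state phi :
  braket phi pair_state = \sum_s Num.conj (phi (transversal s)) * w #|s|.
Proof.
rewrite /braket (bigID (fun A => transversal (excited A) == A)) /= addrC.
rewrite big1 ?add0r => [|A /negbTE nA]; last by rewrite ffunE nA mulr0.
rewrite (reindex_onto (@transversal n) (@excited n)) => [|A /eqP //].
apply: eq_big => [s|s _]; first by rewrite transversalK !eqxx.
by rewrite ffunE transversalK eqxx.
Qed.

(** Virtual orbitals are indexed by ['I_(n.*2 - n)]; this equality casts that index to the pair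
    whose upper mode is meant. *)
Lemma dim_virtual : (n.*2 - n = n)%N. Proof. lia. Qed.

Definition virtual_mx : 'M[C]_(n.*2 - n, n.*2) :=
  \matrix_(a, j) (j == mode (cast_ord dim_virtual a) true)%:R.

Lemma sum_virtual (V : nmodType) (F : 'I_(n.*2 - n) -> V) :
  \sum_a F a = \sum_mu F (cast_ord (esym dim_virtual) mu).
Proof.
rewrite (reindex (cast_ord (esym dim_virtual))) //=.
by exists (cast_ord dim_virtual) => a _; rewrite ?cast_ordK ?cast_ordKV.
Qed.

(** The inner product with an occupied orbital reads off a lower coordinate, so the orthogonal
    complement is the span of the upper modes. *)
Lemma virtual_mx_basis : complement_basis (pair_mx 1 0) virtual_mx.
Proof.
have dotE (v : 'rV[C]_n.*2) mu : dotmx v (row mu (pair_mx 1 0)) = v 0 (mode mu false).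
  rewrite dotmxE mxE sum_modes (bigD1 mu) //= big1 ?addr0 => [|l /negbTE nl].
    by rewrite !mxE !pair_of_mode !odd_mode eqxx rmorph1 rmorph0 mulr1 mulr0 addr0.
  by rewrite !mxE !pair_of_mode nl rmorph0 !mulr0 addr0.
split.
  apply/unitarymxP/matrixP => a c; rewrite !mxE.
  rewrite (bigD1 (mode (cast_ord dim_virtual a) true)) //= big1 ?addr0 => [|l /negbTE nl].
    by rewrite !mxE eqxx mul1r mode_inj2 andbT (inj_eq (@cast_ord_inj _ _ _)) rmorph_nat.
  by rewrite !mxE nl mul0r.
move=> v; split => [/submxP[D ->] mu|v0].
  rewrite dotE mxE big1 // => a _; rewrite mxE mode_inj2 andbF mulr0 //.
apply/submxP; exists (\row_a v 0 (mode (cast_ord dim_virtual a) true)).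
apply/rowP => j; rewrite -(pair_ofK j); case: (odd j); rewrite mxE sum_virtual.
  rewrite (bigD1 (pair_of j)) //= big1 ?addr0 => [|l /negbTE nl].
    by rewrite !mxE cast_ordKV eqxx mulr1.
  by rewrite !mxE cast_ordKV mode_inj2 eq_sym nl mulr0.
rewrite -dotE v0 big1 // => l _.
by rewrite !mxE mode_inj2 andbF mulr0.
Qed.

(** A single excitation of [G] lives on sets with exactly one upper mode, where the coefficient of
    the state is [w 1] or zero. *)
Lemma brillouin_pair_state :
  w 1 = 0 -> brillouin (pair_mx 1 0) virtual_mx pair_state = 0.
Proof.
move=> w1; rewrite /brillouin big1 ?sqrtr0 // => a _; rewrite big1 // => mu _.
suff E : braket (single_excitation (pair_mx 1 0) virtual_mx a mu) pair_state = 0.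
  by rewrite /fidelity E Normc.normc0 expr0n.
apply: big1 => A _.
have [->|nz] := eqVneq (single_excitation (pair_mx 1 0) virtual_mx a mu A) 0.
  by rewrite rmorph0 mul0r.
have [i [iA]] := create_neq0 nz; rewrite !mxE.
have [ei _|_] := eqVneq i; last by rewrite eqxx.
case/annihilate_neq0 => k /slater_ground evenA.
rewrite [pair_state A]ffunE.
(* Removing the new mode [i] from [A] and restoring the annihilated [k] gives a set occupied in [G],
   hence without upper modes; thus [i] is the only upper mode of [A]. *)
have -> : excited A = [set cast_ord dim_virtual a].
  apply/setP => nu; rewrite !inE.
  have [->|ne] := eqVneq nu; first by rewrite -ei iA.
  apply/negP => nuA; have := evenA (mode nu true).
  by rewrite !inE ei mode_inj2 andbT ne nuA orbT odd_mode => /(_ isT).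
by rewrite cards1 w1 if_same mulr0.
Qed.

End PairState.

(** * Overlaps and norm of the ground determinant plus double excitations *)

Section DoubleExcitation.
Variables (R : realType) (n : nat).
Local Notation C := R[i].

Lemma conj_real (x : R) : Num.conj (x%:C : C) = x%:C.
Proof. exact: conjc_real. Qed.

Definition double_weight (a b : R) (k : nat) : C :=
  ((k == 0)%:R * a + (k == 2)%:R * b)%:C.

(** Subsets are grouped by size, and only sizes 0 and 2 carry weight. With suitable [F] this yields
    both the overlap with a rotated determinant and the norm. *)
Lemma double_weight_sum a b (F : nat -> R) :
  \sum_(s : {set 'I_n}) (F #|s|)%:C * double_weight a b #|s|
  = (F 0 * a + 'C(n, 2)%:R * F 2 * b)%:C.
Proof.
have count k : \sum_(s : {set 'I_n}) (#|s| == k)%:R = 'C(n, k)%:R :> R.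
  have := card_draws 'I_n k; rewrite card_ord => <-.
  rewrite -natr_sum -sum1_card [in RHS]big_mkcond /=.
  by congr _%:R; apply: eq_bigr => s _; rewrite inE; case: eqP.
have -> : F 0 * a + 'C(n, 2)%:R * F 2 * b =
   \sum_(s : {set 'I_n}) F #|s| * ((#|s| == 0)%:R * a + (#|s| == 2)%:R * b).
  have -> : F 0 * a = \sum_(s : {set 'I_n}) (#|s| == 0)%:R * (F 0 * a).
    by rewrite -mulr_suml count bin0 mul1r.
  rewrite -count !mulr_suml -big_split /=.
  by apply: eq_bigr => s _; case: #|s| => [|[|[|k]]] /=; ring.
by rewrite rmorph_sum /=; apply: eq_bigr => s _; rewrite -rmorphM.
Qed.

Lemma braket_double a b (u v : R) :
  braket (slater (pair_mx n u%:C v%:C)) (pair_state n (double_weight a b))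
  = (u ^+ n * a + 'C(n, 2)%:R * (u ^+ (n - 2) * v ^+ 2) * b)%:C.
Proof.
rewrite braket_pair_state.
have -> : u ^+ n = u ^+ (n - 0) * v ^+ 0 by rewrite subn0 expr0 mulr1.
rewrite -(double_weight_sum a b (fun k => u ^+ (n - k) * v ^+ k)).
apply: eq_bigr => s _; congr (_ * _).
by rewrite slater_pair_mx -!rmorphXn -rmorphM conj_real.
Qed.

Lemma normalized_double a b :
  a ^+ 2 + 'C(n, 2)%:R * b ^+ 2 = 1 -> normalized (pair_state n (double_weight a b)).
Proof.
move=> ab; rewrite /normalized braket_pair_state.
rewrite (eq_bigr (fun s : {set 'I_n} =>
    ((#|s| == 0)%:R * a + (#|s| == 2)%:R * b)%:C * double_weight a b #|s|)).
  rewrite (double_weight_sum a b (fun k => (k == 0)%:R * a + (k == 2)%:R * b)) /=.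
  by rewrite !(mulr1n, mulr0n, mul0r, mul1r, addr0, add0r) -mulrA -!expr2 ab.
move=> s _; rewrite ffunE transversalK eqxx /double_weight.
by rewrite conj_real.
Qed.

Lemma fidelity_real (phi psi : fock R n.*2) (x : R) :
  braket phi psi = x%:C -> fidelity phi psi = x ^+ 2.
Proof.
by move=> e; rewrite /fidelity e /= expr0n addr0 sqr_sqrtr ?sqr_ge0.
Qed.

Lemma fidelity_double a b (u v : R) : 
  fidelity (slater (pair_mx n u%:C v%:C)) (pair_state n (double_weight a b))
  = (u ^+ n * a + 'C(n, 2)%:R * (u ^+ (n - 2) * v ^+ 2) * b) ^+ 2.
Proof. exact/fidelity_real/braket_double. Qed.

Lemma pair_mx_real_unitary (u v : R) :
  u ^+ 2 + v ^+ 2 = 1 -> pair_mx n u%:C v%:C \is unitarymx.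
Proof.
move=> uv; apply: pair_mx_unitary.
by rewrite !conj_real -!rmorphM -rmorphD /= -!expr2 uv.
Qed.

End DoubleExcitation.

(** * Real inequalities for the rotation gain and for the limiting weight *)

Lemma bernoulli_ineq (R : realDomainType) (x : R) n :
  -1 <= x -> 1 + n%:R * x <= (1 + x) ^+ n.
Proof.
move=> x1; elim: n => [|n IH]; first by rewrite mul0r addr0 expr0.
rewrite exprS; apply: le_trans (_ : (1 + x) * (1 + n%:R * x) <= _).
  rewrite -natr1; have : 0 <= n%:R * (x * x) by rewrite mulr_ge0 // -expr2 sqr_ge0.
  by nra.
by rewrite ler_wpM2l //; lra.
Qed.

Lemma bin2_natr (R : realFieldType) k :
  'C(k.+2, 2)%:R = (k%:R + 2) * (k%:R + 1) / 2 :> R.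
Proof.
have := bin_ffact k.+2 2; rewrite !ffactnS ffactn0 muln1 /= => e.
have : ('C(k.+2, 2) * 2)%:R = (k.+2 * k.+1)%:R :> R by rewrite -e.
rewrite !natrM -[in RHS]addn2 -[k.+1 in RHS]addn1 !natrD => e2.
by apply: (mulIf (x := 2)); rewrite ?pnatr_eq0 // divfK ?pnatr_eq0.
Qed.

(* The factor [(1 + x) ^- n], with [x = 1 / n^2] the squared tangent, is
   at least [1 - n / (n^2 + 1)]; the gain from the double excitations beats it. *)
Lemma rotation_gain (R : realFieldType) (k : nat) (u2 : R) :
  (0 < k)%N -> u2 = 1 - ((k%:R + 2) ^+ 2 + 1)^-1 ->
  1 < u2 ^+ k.+2 * (1 + (k%:R + 1) / (2 * k%:R * (k%:R + 2))) ^+ 2.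
Proof.
move=> k0 ->; set K : R := k%:R.
have K1 : 1 <= K by rewrite /K ler1n.
set y := (_ ^+ 2 + 1)^-1.
have y0 : 0 < y by rewrite invr_gt0; nra.
have yE : y * ((K + 2) ^+ 2 + 1) = 1 by rewrite mulVf //; apply/eqP; nra.
have y1 : y <= 1 by nra.
have := @bernoulli_ineq R (- y) k.+2; rewrite lerN2 => /(_ y1).
rewrite -addn2 natrD -/K => B.
set z := (K + 1) / _.
have zE : z * (2 * K * (K + 2)) = K + 1 by rewrite /z divfK //; apply/eqP; nra.
have z0 : 0 < z by rewrite divr_gt0 //; nra.
have D : 0 < 1 - (K + 2) * y by nra.
apply: lt_le_trans (_ : (1 - (K + 2) * y) * (1 + z) ^+ 2 <= _); last first.
  by rewrite ler_wpM2r ?sqr_ge0 //; move: B; rewrite mulrN.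
(* Dropping [z ^+ 2] loses little: the remaining excess over 1 is an explicit positive fraction. *)
apply: lt_le_trans (_ : (1 - (K + 2) * y) * (1 + 2 * z) <= _); last first.
  by rewrite ler_wpM2l ?ltW //; nra.
have -> : z = (K + 1) / (2 * K * (K + 2)) by [].
have -> : y = ((K + 2) ^+ 2 + 1)^-1 by [].
rewrite -subr_gt0.
have -> : (1 - (K + 2) * ((K + 2) ^+ 2 + 1)^-1) *
    (1 + 2 * ((K + 1) / (2 * K * (K + 2)))) - 1 =
  (2 * K + 3) / (K * (K + 2) * ((K + 2) ^+ 2 + 1)).
  field; rewrite ?andbA; do ?[apply/andP; split]; apply/eqP; nra.
by rewrite divr_gt0 //; nra.
Qed.

(** The shortfall from [2/3] is [(6k + 4) / (3 (3k^2 + 3k + 2))], which is below [1/k]; hence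
    [k > 2/d] suffices for a margin [d]. *)
Lemma weight_near_two_thirds (R : realType) (c : R) : c < 2%:R / 3%:R ->
  exists2 k : nat, (0 < k)%N &
    c < 2 * k%:R ^+ 2 / (3 * k%:R ^+ 2 + 3 * k%:R + 2).
Proof.
move=> hc; set d := 2%:R / 3%:R - c.
have d0 : 0 < d by rewrite subr_gt0.
have := @archi_boundP R (2 / d); rewrite divr_ge0 ?ltW // => /(_ isT).
set N := Num.bound _ => hN; exists N.+1 => //.
set K : R := N.+1%:R.
have K1 : 1 <= K by rewrite /K ler1n.
have hK : 2 < K * d.
  rewrite -ltr_pdivrMr //; apply: lt_le_trans hN _.
  by rewrite ler_nat.
have D : 0 < 3 * K ^+ 2 + 3 * K + 2 by nra.
rewrite ltr_pdivlMr //.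
have -> : c = 2%:R / 3%:R - d by rewrite /d; ring.
have Kd : 2 * K <= K * K * d by nra.
have dK : 0 <= d * K by nra.
by rewrite expr2; lra.
Qed.

(** * Choice of the parameters, and refutation of the universal claim *)

Theorem theorem6 (R : realType) (c : R) (hc : c < 2%:R / 3%:R) :
  (exists (m n : nat) (psi : fock R m)
          (g : 'M[R[i]]_(n, m)) (f : 'M[R[i]]_(m - n, m)),
      [/\ (n <= m)%N, fermionic n psi & normalized psi] /\
      [/\ g \is unitarymx, complement_basis g f,
          c < fidelity (slater g) psi & brillouin g f psi = 0] /\
      (exists2 H : fock R m, is_slater n H &
          fidelity (slater g) psi < fidelity H psi))
  /\
  ~ (forall (m n : nat) (psi : fock R m)
            (g : 'M[R[i]]_(n, m)) (f : 'M[R[i]]_(m - n, m)),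
      (n <= m)%N -> fermionic n psi -> normalized psi ->
      g \is unitarymx -> complement_basis g f ->
      c < fidelity (slater g) psi -> brillouin g f psi = 0 ->
      globally_closest n psi (slater g)).
Proof.
(* The counterexample is built once and then reused to refute the universal claim. *)
apply: (_ : forall A B : Prop, A -> (A -> B) -> A /\ B) => [A B HA AB||].
- by split; [|exact: AB].
  have [k k0 ck] := weight_near_two_thirds hc.
  set K : R := k%:R in ck; have K1 : 1 <= K by rewrite /K ler1n.
  set a2 := 2 * K ^+ 2 / _ in ck.
  have a2gt0 : 0 < a2 by rewrite divr_gt0 //; nra.
  pose a := Num.sqrt a2; pose b := a / K.
  have a2E : a ^+ 2 = a2 by rewrite sqr_sqrtr ?ltW.
  pose n := k.+2.
  (* This is the squared cosine of the angle of tangent [1 / n], in the form suited to Bernoulli's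
     inequality; below, [u] and [v] are the cosine and sine. *)
  pose u2 : R := 1 - ((K + 2) ^+ 2 + 1)^-1.
  have u2E : u2 = (K + 2) ^+ 2 / ((K + 2) ^+ 2 + 1).
    by rewrite /u2; field; apply/eqP; nra.
  have u2gt0 : 0 < u2 by rewrite u2E divr_gt0 //; nra.
  pose u := Num.sqrt u2; pose v := u / (K + 2).
  have uE : u ^+ 2 = u2 by rewrite sqr_sqrtr ?ltW.
  have Fg : fidelity (slater (pair_mx n 1 0)) (pair_state n (double_weight a b)) = a2.
    have := fidelity_double n a b 1 0.
    by rewrite rmorph1 rmorph0 => ->; rewrite !expr1n expr0n !mulr0 mul0r addr0 mul1r.
  exists n.*2, n, (pair_state n (double_weight a b)), (pair_mx n 1 0), (virtual_mx R n).
  split; last split.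
  - split; first lia.
      exact: fermionic_pair_state.
    apply: normalized_double; rewrite bin2_natr exprMn exprVn a2E /a2 -/K.
    by field; rewrite ?andbA; do ?[apply/andP; split]; apply/eqP; nra.
  - split.
    + by apply: pair_mx_unitary; rewrite rmorph1 rmorph0 mulr1 mulr0 addr0.
    + exact: virtual_mx_basis.
    + by rewrite Fg.
    + by apply: brillouin_pair_state; rewrite /double_weight !mul0r addr0 rmorph0.
  - exists (slater (pair_mx n u%:C v%:C)).
      exists (pair_mx n u%:C v%:C) => //; apply: pair_mx_real_unitary.
      rewrite exprMn exprVn uE u2E.
      by field; rewrite ?andbA; do ?[apply/andP; split]; apply/eqP; nra.
    rewrite Fg fidelity_double.
    (* With [v / u = 1 / (k + 2)] and [b / a = 1 / k], the double excitations contribute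
       [(k + 1) / (2 k (k + 2))] relative to the term of [G]. *)
    have -> : u ^+ n * a + 'C(n, 2)%:R * (u ^+ (n - 2) * v ^+ 2) * b =
        u ^+ n * a * (1 + (K + 1) / (2 * K * (K + 2))).
      rewrite bin2_natr /n subSS subSS subn0 -addn2 exprD /v /b -/K.
      by field; rewrite ?andbA; do ?[apply/andP; split]; apply/eqP; nra.
    rewrite 2!exprMn a2E -exprM mulnC exprM uE [_ * a2]mulrC -[X in _ < X]mulrA ltr_pMr //.
    exact: rotation_gain.
move=> [m [n [psi [g [f [[nm fpsi npsi] [[ug bf cg Bg] [H sH lt]]]]]]]] closest.
have [_ /(_ H sH)] := closest m n psi g f nm fpsi npsi ug bf cg Bg.
by rewrite leNgt lt.
Qed.
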